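(* For an arbitrary instance $(G=(V,E),p,m)$ of the IC-M model and any deadline constraint $\tau\ge 1$, the influence function $\sigma_\tau:2^V\to\mathbb{R}_+$ is monotone and submodular.
   Context: IC-M model (Independent Cascade with Meeting events). Let $G=(V,E)$ be a finite directed graph with functions $p,m:E\to[0,1]$ (influence and meeting probabilities; $p(u,v)=m(u,v)=0$ if $(u,v)\notin E$). Time is discrete, $0,1,2,\dots$. At step $0$ exactly the nodes of the seed set $S\subseteq V$ are active. At each step $t\ge 1$, every node $u$ that became active at a step before $t$ meets each of its currently inactive out-neighbors $v$ independently with probability $m(u,v)$ (independently over pairs and steps). If this is the first meeting of $u$ and $v$ since $u$'s activation, $u$ gets its single chance to activate $v$, succeeding independently with probability $p(u,v)$; on success $v$ becomes active at step $t$ and starts to propagate influence at step $t+1$. Active nodes stay active. For a deadline $\tau\in\mathbb{Z}_+$, $\sigma_\tau(S)$ is the expected number of nodes that are active by the end of step $\tau$ when the seed set is $S$. A set function $f:2^V\to\mathbb{R}$ is monotone if $f(S_1)\le f(S_2)$ whenever $S_1\subseteq S_2$, and submodular if $f(S_1\cup\{w\})-f(S_1)\ge f(S_2\cup\{w\})-f(S_2)$ for all $S_1\subseteq S_2\subseteq V$ and all $w\in V\setminus S_2$. *)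

(* Defs.v *)
From HB Require Import structures.
From mathcomp Require Import all_boot all_order all_algebra.
From mathcomp Require Import reals.

Set Implicit Arguments.
Unset Strict Implicit.
Unset Printing Implicit Defensive.

Import Order.TTheory GRing.Theory Num.Theory.
Local Open Scope ring_scope.

Record icm_instance (R : realType) (V : finType) := ICM {
  edge : rel V;
  infl : V -> V -> R;
  meet : V -> V -> R;
  infl_bounds : forall u v, 0 <= infl u v <= 1;
  meet_bounds : forall u v, 0 <= meet u v <= 1;
  infl_nonedge : forall u v, ~~ edge u v -> infl u v = 0;
  meet_nonedge : forall u v, ~~ edge u v -> meet u v = 0
}.

Section Process.
Variables (R : realType) (V : finType) (I : icm_instance R V).

(* The random choices of one time step. For an ordered pair (u, v), the first
   bit says whether u meets v at this step and the second one whether an attempt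
   of u to activate v at this step would succeed. Fresh bits are drawn at every
   step; bits that the dynamics does not call for are ignored. *)
Definition coins := {ffun V * V -> bool * bool}.

Definition bernoulli_weight (q : R) (b : bool) : R := if b then q else 1 - q.

Definition coins_pr (c : coins) : R :=
  \prod_(e : V * V) (bernoulli_weight (meet I e.1 e.2) (c e).1 *
                     bernoulli_weight (infl I e.1 e.2) (c e).2).

(* The active nodes, and the pairs (u, v) such that u has met v since the
   activation of u. *)
Record state := State { active : {set V}; met : {set V * V} }.

Definition init (S : {set V}) : state := State S set0.

Definition meets (s : state) (c : coins) (u v : V) : bool :=
  [&& u \in active s, edge I u v, v \notin active s & (c (u, v)).1].

Definition activates (s : state) (c : coins) (u v : V) : bool :=
  [&& meets s c u v, (u, v) \notin met s & (c (u, v)).2].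

Definition step (s : state) (c : coins) : state :=
  State (active s :|: [set v | [exists u, activates s c u v]])
        (met s :|: [set e | meets s c e.1 e.2]).

(* Runs of tau steps: entry i of w holds the choices of step i.+1, and distinct
   steps are independent. *)
Definition run_pr (tau : nat) (w : tau.-tuple coins) : R :=
  \prod_(i < tau) coins_pr (tnth w i).

Definition final_state (S : {set V}) (tau : nat) (w : tau.-tuple coins) : state :=
  foldl step (init S) w.

Definition sigma (tau : nat) (S : {set V}) : R :=
  \sum_(w : tau.-tuple coins) run_pr w * #|active (final_state S w)|%:R.

Lemma bernoulli_weight_ge0 q b : 0 <= q <= 1 -> 0 <= bernoulli_weight q b.
Proof. by case/andP=> q0 q1; case: b; rewrite //= subr_ge0. Qed.

Lemma run_pr_ge0 tau (w : tau.-tuple coins) : 0 <= run_pr w.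
Proof.
apply: prodr_ge0 => i _; apply: prodr_ge0 => e _.
by rewrite mulr_ge0 ?bernoulli_weight_ge0 ?meet_bounds ?infl_bounds.
Qed.

Lemma sum_coins_pr : \sum_(c : coins) coins_pr c = 1.
Proof.
rewrite /coins_pr -(bigA_distr_bigA (fun e (b : bool * bool) =>
  bernoulli_weight (meet I e.1 e.2) b.1 * bernoulli_weight (infl I e.1 e.2) b.2)).
apply: big1 => e _.
rewrite -(pair_bigA _ (fun a b => bernoulli_weight (meet I e.1 e.2) a *
                                  bernoulli_weight (infl I e.1 e.2) b)) /=.
have q1q (q : R) : q + (1 - q) = 1 by rewrite addrC subrK.
by rewrite !big_bool /= -!mulrDr !q1q !mulr1 q1q.
Qed.

Lemma sum_run_pr tau : \sum_(w : tau.-tuple coins) run_pr w = 1.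
Proof.
rewrite (reindex (fun f : {ffun 'I_tau -> coins} => [tuple f i | i < tau])) /=.
  under eq_bigr => f _ do
    (rewrite /run_pr; under eq_bigr => i _ do rewrite tnth_mktuple).
  rewrite -(bigA_distr_bigA (fun=> coins_pr)).
  by apply: big1 => i _; exact: sum_coins_pr.
exists (fun w => [ffun i => tnth w i]) => [f _|w _].
  by apply/ffunP => i; rewrite ffunE tnth_mktuple.
by apply: eq_from_tnth => i; rewrite tnth_mktuple ffunE.
Qed.

Lemma sigma_ge0 tau S : 0 <= sigma tau S.
Proof. by apply: sumr_ge0 => w _; rewrite mulr_ge0 ?run_pr_ge0. Qed.

End Process.

Section SetFunctions.
Variables (R : realType) (V : finType).

Definition monotone_setfun (f : {set V} -> R) : Prop :=
  forall S1 S2 : {set V}, S1 \subset S2 -> f S1 <= f S2.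

Definition submodular (f : {set V} -> R) : Prop :=
  forall (S1 S2 : {set V}) (w : V), S1 \subset S2 -> w \notin S2 ->
    f (S2 :|: [set w]) - f S2 <= f (S1 :|: [set w]) - f S1.

End SetFunctions.

(* Main.v *)
Require Import Defs.
From HB Require Import structures.
From mathcomp Require Import all_boot all_order all_algebra.
From mathcomp Require Import reals.

(** Only the first meeting of [u] and [v] after the activation of [u] matters,
    so the success bit of each pair can be drawn once, before the process
    starts. Given the set of successful pairs and the meeting bits, the set of
    active nodes at time [tau] is a union, over the seeds, of the sets reached
    from each seed; its size is thus a coverage function of the seed set, and
    [sigma] is an average of coverage functions. *)

Set Implicit Arguments.
Unset Strict Implicit.
Unset Printing Implicit Defensive.

Import Order.TTheory GRing.Theory Num.Theory.
Local Open Scope ring_scope.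

Section Coverage.
Variables (V W : finType) (F : {set V} -> {set W}).
Hypothesis FU : {morph F : A B / A :|: B}.

Lemma morph_setU_subset (A B : {set V}) : A \subset B -> F A \subset F B.
Proof. by move/setUidPr <-; rewrite FU subsetUl. Qed.

(** On the right [F A] occurs only as a subtracted set, so the gain shrinks as [A] grows: this is
    the source of submodularity. *)
Lemma card_morph_setU (R : pzRingType) (A B : {set V}) :
  #|F (A :|: B)|%:R - #|F A|%:R = #|F B :\: F A|%:R :> R.
Proof.
rewrite FU -(cardsID (F A) (F A :|: F B)) setUK setDUl setDv.
by rewrite set0U natrD addrAC subrr add0r.
Qed.

End Coverage.

Section Mean.
Variables (R : realType) (V : finType) (I : icm_instance R V).
Variables (T : Type) (st : T -> coins V -> T) (g : T -> R).

(** The expectation of [g] after [n] steps, computed by conditioning on the first step. The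
    transition [st] is left abstract to cover both [step] and [live_step]. *)
Fixpoint walk_mean (n : nat) (s : T) : R :=
  if n is m.+1 then \sum_c coins_pr I c * walk_mean m (st s c) else g s.

Lemma walk_meanE n s :
  \sum_(w : n.-tuple (coins V)) run_pr I w * g (foldl st s w) = walk_mean n s.
Proof.
elim: n s => [|n IHn] s /=.
  rewrite (big_pred1 [tuple]) => [|w]; last by rewrite (tuple0 w) /= eqxx.
  by rewrite /run_pr big_ord0 mul1r.
under [RHS]eq_bigr => c _ do rewrite -IHn mulr_sumr.
rewrite pair_bigA /=.
rewrite (reindex (fun p : coins V * n.-tuple (coins V) => [tuple of p.1 :: p.2])) /=.
  apply: eq_bigr => -[c w] _ /=; rewrite mulrA; congr (_ * _).
  rewrite /run_pr big_ord_recl; congr (_ * _).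
  by apply: eq_bigr => i _; rewrite tnthS.
exists (fun w => (thead w, [tuple of behead w])) => [[c w] _|w _] /=.
  by congr (_, _); apply: val_inj.
by rewrite [RHS]tuple_eta; apply: val_inj.
Qed.

End Mean.

Section LiveEdges.
Variables (R : realType) (V : finType) (I : icm_instance R V).
Implicit Types (A B S : {set V}) (L M : {set V * V}) (c : coins V).

(** No met pairs are recorded: after one meeting along a pair of [L] the target is active, so later
    meetings change nothing. Without that memory the step commutes with unions. *)
Definition live_step L A c : {set V} :=
  A :|: [set v | [exists u,
    [&& u \in A, edge I u v, (u, v) \in L & (c (u, v)).1]]].

Lemma live_stepU L c : {morph (fun A => live_step L A c) : A B / A :|: B}.
Proof.
move=> A B; apply/setP => v; rewrite !inE.
have -> : [exists u, [&& u \in A :|: B, edge I u v, (u, v) \in L & (c (u, v)).1]]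
   = [exists u, [&& u \in A, edge I u v, (u, v) \in L & (c (u, v)).1]]
  || [exists u, [&& u \in B, edge I u v, (u, v) \in L & (c (u, v)).1]].
  apply/existsP/orP => [[u]|[] /existsP[u uP]].
  - by rewrite inE andb_orl => /orP[] uP; [left|right]; apply/existsP; exists u.
  - by exists u; rewrite inE andb_orl uP.
  - by exists u; rewrite inE andb_orl uP orbT.
by rewrite orbACA.
Qed.

Lemma foldl_live_stepU L (w : seq (coins V)) :
  {morph (fun A => foldl (live_step L) A w) : A B / A :|: B}.
Proof. by elim: w => //= c w IHw A B; rewrite live_stepU IHw. Qed.

(* Pairs pointing to an active node are irrelevant. *)
Lemma live_mean_local (g : {set V} -> R) n A L M :
    (forall u v, v \notin A -> ((u, v) \in L) = ((u, v) \in M)) ->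
  walk_mean I (live_step L) g n A = walk_mean I (live_step M) g n A.
Proof.
elim: n A => //= n IHn A LM; apply: eq_bigr => c _; congr (_ * _).
have -> : live_step L A c = live_step M A c.
  apply/setP => v; rewrite !inE; case: (boolP (v \in A)) => //= vA.
  by apply: eq_existsb => u; rewrite LM.
by apply: IHn => u v; rewrite !inE negb_or => /andP[vA _]; exact: LM.
Qed.

Definition live_pr (x : {ffun V * V -> bool}) : R :=
  \prod_(e : V * V) bernoulli_weight (infl I e.1 e.2) (x e).

Lemma live_pr_ge0 x : 0 <= live_pr x.
Proof. by apply: prodr_ge0 => e _; rewrite bernoulli_weight_ge0 ?infl_bounds. Qed.

Lemma sum_live_pr : \sum_x live_pr x = 1.
Proof.
rewrite /live_pr
  -(bigA_distr_bigA (fun e b => bernoulli_weight (infl I e.1 e.2) b)).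
by apply: big1 => e _; rewrite big_bool /= addrC subrK.
Qed.

(* Exchanges the fresh success bit of each pair that meets at this step with
   the one drawn in advance. *)
Definition swap_success (s : state V) (p : coins V * {ffun V * V -> bool}) :
    coins V * {ffun V * V -> bool} :=
  ([ffun e => ((p.1 e).1, if meets I s p.1 e.1 e.2 then p.2 e else (p.1 e).2)],
   [ffun e => if meets I s p.1 e.1 e.2 then (p.1 e).2 else p.2 e]).

Lemma meets_swap_success s p u v :
  meets I s (swap_success s p).1 u v = meets I s p.1 u v.
Proof. by rewrite /meets ffunE. Qed.

Lemma swap_successK s : involutive (swap_success s).
Proof.
move=> p; rewrite {1}/swap_success.
case: p => c x; congr (_, _); apply/ffunP => e;
  rewrite ffunE meets_swap_success /= !ffunE /=;
  by case: ifP => -> //; rewrite -surjective_pairing.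
Qed.

(** The two exchanged bits of a pair have the same Bernoulli law, and the meeting bits are
    untouched. *)
Lemma pr_swap_success s p :
  coins_pr I (swap_success s p).1 * live_pr (swap_success s p).2 =
  coins_pr I p.1 * live_pr p.2.
Proof.
rewrite /coins_pr /live_pr -!big_split; apply: eq_bigr => e _ /=.
by rewrite !ffunE; case: ifP => //= _; rewrite mulrAC.
Qed.

(** The pairs whose single attempt is still to come and will succeed; a pair in [M] has spent its
    attempt. *)
Definition pending M (x : {ffun V * V -> bool}) := [set e | x e && (e \notin M)].

Lemma live_step_swap_success s p (q := swap_success s p) :
  live_step (pending (met s) q.2) (active s) q.1 = active (step I s p.1).
Proof.
apply/setP => v; rewrite !inE; case: (boolP (v \in active s)) => //= vA.
apply: eq_existsb => u; rewrite /activates !inE !ffunE /= /meets vA /=.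
by case: (u \in _) => //=; case: (edge _ _ _) => //=; case: (p.1 _).1;
   rewrite ?andbF ?andbT // andbC.
Qed.

(** If [v] stays inactive, a pair [(u, v)] meeting now either had met before or fails now, so it is
    pending on neither side. The other pairs keep their bit and their status. *)
Lemma pending_swap_success s p (q := swap_success s p) u v :
    v \notin active (step I s p.1) ->
  ((u, v) \in pending (met s) q.2) =
  ((u, v) \in pending (met (step I s p.1)) p.2).
Proof.
rewrite !inE negb_or negb_exists => /andP[vA /forallP/(_ u)].
rewrite !ffunE /= /activates.
by case: (meets _ _ _ _ _) => /=; rewrite ?orbF // orbT andbF andbC => /negbTE.
Qed.

Lemma walk_mean_live (g : {set V} -> R) n (s : state V) :
  walk_mean I (step I) (fun s' => g (active s')) n s =
  \sum_x live_pr x * walk_mean I (live_step (pending (met s) x)) g n (active s).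
Proof.
elim: n s => [|n IHn] s /=; first by rewrite -mulr_suml sum_live_pr mul1r.
under eq_bigr => c _ do rewrite IHn mulr_sumr.
under [RHS]eq_bigr => x _ do rewrite mulr_sumr.
rewrite [RHS]exchange_big !pair_bigA /=.
(* After this measure-preserving change of variables both processes reach the same active set in
   their first step. Their pending pairs then differ only at active targets, which [live_mean_local]
   ignores. *)
rewrite [RHS](reindex_inj (inv_inj (swap_successK s))) /=.
apply: eq_bigr => p _.
rewrite !mulrA [live_pr _ * _]mulrC pr_swap_success live_step_swap_success.
by congr (_ * _); apply/esym/live_mean_local => u v; exact: pending_swap_success.
Qed.

Lemma sigma_live tau S :
  sigma I tau S = \sum_x \sum_(w : tau.-tuple (coins V))
    live_pr x * run_pr I w * #|foldl (live_step (pending set0 x)) S w|%:R.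
Proof.
rewrite /sigma (walk_meanE I (step I) (fun s => #|active s|%:R)).
rewrite (walk_mean_live (fun A => #|A|%:R)); apply: eq_bigr => x _.
by rewrite -walk_meanE mulr_sumr; apply: eq_bigr => w _; rewrite mulrA.
Qed.

End LiveEdges.

Theorem theorem2 (R : realType) (V : finType) (I : icm_instance R V)
    (tau : nat) (htau : (1 <= tau)%N) :
  monotone_setfun (sigma I tau) /\ submodular (sigma I tau).
Proof.
have pr_ge0 x (w : tau.-tuple (coins V)) : 0 <= live_pr I x * run_pr I w.
  by rewrite mulr_ge0 ?live_pr_ge0 ?run_pr_ge0.
split=> [S1 S2 S12|S1 S2 v S12 _]; rewrite !sigma_live.
  apply: ler_sum => x _; apply: ler_sum => w _.
  rewrite ler_wpM2l // ler_nat subset_leq_card //.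
  exact: (morph_setU_subset (foldl_live_stepU I _ w)).
(* The weights are nonnegative and do not depend on the seeds, so the gains can be compared for each
   fixed [x] and [w]. *)
rewrite -!sumrB; apply: ler_sum => x _; rewrite -!sumrB; apply: ler_sum => w _.
have FU := foldl_live_stepU I (pending set0 x) w.
rewrite -!mulrBr ler_wpM2l // !(card_morph_setU FU) ler_nat subset_leq_card //.
by rewrite setDS // (morph_setU_subset FU).
Qed.
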